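(* If $L$ is a nonempty separable zerodimensional compact space, then there exists a smooth compactification $\gamma\omega$ of $\omega$ such that $\gamma\omega\setminus\omega$ is homeomorphic to $L$.
   Context: Compact spaces are Hausdorff; a compact space is zerodimensional if it has a base of clopen sets. $\omega$ is the discrete space of natural numbers. $C(K)$ is the Banach space of real-valued continuous functions on a compact space $K$ with the supremum norm. For a compactification $\gamma\omega$ of $\omega$, the natural copy of $c_0$ in $C(\gamma\omega)$ is the closed subspace $\{f\in C(\gamma\omega): f|(\gamma\omega\setminus\omega)\equiv 0\}$. The compactification $\gamma\omega$ is called smooth if the natural copy of $c_0$ is complemented in $C(\gamma\omega)$, i.e. is the range of a bounded linear projection on $C(\gamma\omega)$. *)

(* Defs.v *)
From HB Require Import structures.
From mathcomp Require Import all_boot all_order all_algebra.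
From mathcomp Require Import all_classical all_reals all_analysis.
From mathcomp Require Import lra.
Import Order.TTheory GRing.Theory Num.Theory.
Import numFieldNormedType.Exports.

Set Implicit Arguments.
Unset Strict Implicit.
Unset Printing Implicit Defensive.

Local Open Scope classical_set_scope.
Local Open Scope ring_scope.

HB.mixin Record isCompactHausdorff T of Topological T := {
  compactHausdorff_compact : compact [set: T];
  compactHausdorff_hausdorff : hausdorff_space T
}.

#[short(type="compactHausdorffType")]
HB.structure Definition CompactHausdorff :=
  { T of Topological T & isCompactHausdorff T }.

Definition separable (T : topologicalType) :=
  exists2 D : set T, countable D & dense D.

(* The library's [zero_dimensional] only asks that clopen sets separate
   points, hence this separate definition. *)
Definition has_clopen_base (T : topologicalType) :=
  exists2 B : set_system T, B `<=` clopen & basis B.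

Definition homeomorphic (X Y : topologicalType) :=
  exists (f : X -> Y) (g : Y -> X),
    [/\ cancel f g, cancel g f, continuous f & continuous g].

Definition embedding (X Y : topologicalType) (f : X -> Y) :=
  injective f /\ @open X = @open (initial_topology f).

Section ContinuousFunctions.
Context (R : realType) (K : compactHausdorffType).

Definition continuous_pred : {pred K -> R^o} :=
  fun f : K -> R^o => `[< continuous f >].

Lemma continuous_predP (f : K -> R^o) :
  reflect (continuous f) (f \in continuous_pred).
Proof. exact: asboolP. Qed.

Lemma continuous_pred_submod : submod_closed continuous_pred.
Proof.
split; first by apply/continuous_predP => x; exact: cvg_cst.
move=> a f g /continuous_predP cf /continuous_predP cg.
apply/continuous_predP => x.
by apply: (@cvgD _ R^o); [apply: (@cvgZr _ R^o); exact: cf|exact: cg].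
Qed.

HB.instance Definition _ :=
  GRing.isSubmodClosed.Build R (K -> R^o) continuous_pred
    continuous_pred_submod.

Record cspace := CSpace {
  cspace_fun :> K -> R^o;
  cspace_continuousb : cspace_fun \in continuous_pred }.

HB.instance Definition _ := [isSub for cspace_fun].
HB.instance Definition _ := [Choice of cspace by <:].
HB.instance Definition _ := [SubChoice_isSubLmodule of cspace by <:].

Lemma cspace_continuous (f : cspace) : continuous f.
Proof. exact/continuous_predP/cspace_continuousb. Qed.

Definition sup_norm (f : cspace) : R := sup [set `|f x| | x in [set: K]].

Lemma cspace_has_ubound (f : cspace) :
  has_ubound [set `|f x| | x in [set: K]].
Proof.
have /compact_bounded [M [_ fM]] : compact (f @` [set: K]).
  apply: continuous_compact; last exact: compactHausdorff_compact.
  exact/continuous_subspaceT/cspace_continuous.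
exists (M + 1) => _ [x _ <-].
by apply: (fM (M + 1)); [rewrite ltrDl|exists x].
Qed.

Lemma ler_sup_norm (f : cspace) (x : K) : `|f x| <= sup_norm f.
Proof. by apply: ub_le_sup; [exact: cspace_has_ubound|exists x]. Qed.

Lemma sup_norm_ge0 (f : cspace) : 0 <= sup_norm f.
Proof.
have [K0|/set0P [x _]] := eqVneq [set: K] set0.
  by rewrite /sup_norm K0 image_set0 sup0.
exact: le_trans (normr_ge0 _) (ler_sup_norm f x).
Qed.

Lemma sup_norm_le (f : cspace) (M : R) :
  0 <= M -> (forall x, `|f x| <= M) -> sup_norm f <= M.
Proof.
move=> M0 fM; have [K0|/set0P [x _]] := eqVneq [set: K] set0.
  by rewrite /sup_norm K0 image_set0 sup0.
by apply: ge_sup; [exists `|f x|, x|move=> _ [y _ <-]].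
Qed.

Lemma ler_sup_normD (f g : cspace) :
  sup_norm (f + g) <= sup_norm f + sup_norm g.
Proof.
apply: sup_norm_le => [|x]; first by rewrite addr_ge0 ?sup_norm_ge0.
by apply: le_trans (ler_normD (f x) (g x)) _; rewrite lerD ?ler_sup_norm.
Qed.

Lemma sup_normZ (a : R) (f : cspace) : sup_norm (a *: f) = `|a| * sup_norm f.
Proof.
have le_Z b (g : cspace) : sup_norm (b *: g) <= `|b| * sup_norm g.
  apply: sup_norm_le => [|x]; first by rewrite mulr_ge0 ?sup_norm_ge0.
  suff -> : (b *: g) x = b * g x by rewrite normrM ler_wpM2l ?ler_sup_norm.
  by [].
apply/eqP; rewrite eq_le le_Z /=.
have [->|a0] := eqVneq a 0; first by rewrite normr0 mul0r sup_norm_ge0.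
rewrite -ler_pdivlMl ?normr_gt0 // -normfV.
by apply: le_trans (le_Z a^-1 (a *: f)); rewrite scalerA mulVf // scale1r.
Qed.

Lemma sup_norm_eq0 (f : cspace) : sup_norm f = 0 -> f = 0.
Proof.
move=> f0; apply/val_inj/funext => x; apply/eqP.
by rewrite -normr_le0 -f0 ler_sup_norm.
Qed.

HB.instance Definition _ :=
  Lmodule_isNormed.Build R cspace ler_sup_normD sup_normZ sup_norm_eq0.

Lemma cspace_normE (f : cspace) :
  `|f| = sup [set `|f x| | x in [set: K]].
Proof. by []. Qed.

End ContinuousFunctions.
Arguments cspace : clear implicits.

Section CspaceComplete.
Context (R : realType) (K : compactHausdorffType).

Lemma cspace_ballE (f g : cspace R K) (e : R) : ball f e g = (`|f - g| < e).
Proof. by rewrite -ball_normE. Qed.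

Lemma cspace_complete (F : set_system (cspace R K)) :
  ProperFilter F -> cauchy F -> cvg F.
Proof.
move=> FF /cauchyP Fc.
have approx e : 0 < e -> exists f, F [set h | `|f - h| < e].
  move=> e0; have [f Ff] := Fc e e0; exists f.
  by apply: filterS Ff => h /=; rewrite cspace_ballE.
have ptle (f h : cspace R K) e x : `|f - h| < e -> `|f x - h x| < e.
  by apply: le_lt_trans; exact: (ler_sup_norm (f - h) x).
have ev_cvg x : cvg ((fun f : cspace R K => (f x : R)) @ F).
  apply: (@R_complete R); apply/cauchyP => e e0.
  have [f Ff] := approx e e0; exists (f x).
  apply: (@filterS _ F _ _ _ _ Ff) => h fh; rewrite -ball_normE; exact: ptle.
pose g x : R := lim ((fun f : cspace R K => (f x : R)) @ F).
have fg e f : F [set h | `|f - h| < e] -> forall x, `|f x - g x| <= e.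
  move=> Ff x; apply/ler_addgt0Pr => d d0.
  have /cvgrPdist_lt/(_ _ d0) Fd := ev_cvg x.
  have [h [/= /ptle fh gh]] := filter_ex (filterI Ff Fd).
  rewrite (le_trans (ler_distD (h x) _ _))// lerD//; first exact/ltW/fh.
  by rewrite distrC; exact: ltW.
have g_cts : continuous (g : K -> R^o).
  move=> x; apply/(@cvgrPdist_lt _ R^o) => e e0.
  have e3 : 0 < e / 4 by rewrite divr_gt0.
  have [f /fg fge] := approx _ e3.
  have /(@cvgrPdist_lt _ R^o)/(_ _ e3) := @cspace_continuous R K f x.
  apply: filterS => y fxy.
  have := fge x; have := fge y; rewrite distrC => gy gx.
  have := ler_distD (f y) (f x) (g y); have := ler_distD (f x) (g x) (g y).
  rewrite (distrC (g x) (f x)) (distrC (f y) (g y)) => A B.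
  have -> : e = e / 4 + e / 4 + e / 4 + e / 4 by lra.
  by lra.
pose G := CSpace (introT (continuous_predP _) g_cts).
apply/cvg_ex; exists G; apply/cvgrPdist_lt => e e0.
have e3 : 0 < e / 3 by rewrite divr_gt0.
have [f Ff] := approx _ e3; apply: filterS (Ff) => h fh.
have fG : `|f - G| <= e / 3 by apply: sup_norm_le; [exact: ltW|exact: fg Ff].
have := ler_distD f G h; rewrite (distrC G f) => A.
by move: fh => /= fh; lra.
Qed.

HB.instance Definition _ :=
  Uniform_isComplete.Build (cspace R K) cspace_complete.

End CspaceComplete.

Section Compactifications.
Context (K : compactHausdorffType).

(* [i] exhibits K as a compactification of the discrete space of natural
   numbers, which is identified with [range i]. *)
Definition nat_compactification (i : nat -> K) :=
  embedding i /\ dense (range i).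

Definition remainder (i : nat -> K) : set K := ~` range i.

Definition c0_copy (R : realType) (i : nat -> K) : set (cspace R K) :=
  [set f | forall x, remainder i x -> f x = 0].

End Compactifications.
Arguments c0_copy {K} R i.

Definition bounded_linear_map (R : realType) (V W : normedModType R)
    (f : {linear V -> W}) :=
  exists M : R, forall x, `|f x| <= M * `|x|.

Definition complemented (R : realType) (V : normedModType R) (A : set V) :=
  exists P : {linear V -> V},
    [/\ bounded_linear_map P, forall x, P (P x) = P x & range P = A].

Definition smooth (R : realType) (K : compactHausdorffType) (i : nat -> K) :=
  complemented (c0_copy R i).
Arguments smooth R {K} i.

(* Main.v *)
(** If a compactification of [nat] retracts onto its remainder by a continuous
    map [p], then [f |-> f - f \o p] is a bounded projection onto the natural
    copy of [c0].  A separable compact [L] is the remainder of such a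
    compactification: choose [r : nat -> L] taking every value of a dense
    sequence infinitely often, and add to [L] one isolated point for each [n],
    the point [n] being close to [r n] when [n] is large.  In other words, take
    the closure of [{(r n, n)}] in the product of [L] with the one-point
    compactification of [nat]. *)
Require Import Defs.
From HB Require Import structures.
From mathcomp Require Import all_boot all_order all_algebra.
From mathcomp Require Import all_classical all_reals all_analysis.
Import Order.TTheory GRing.Theory Num.Theory.
Import numFieldNormedType.Exports.

Set Implicit Arguments.
Unset Strict Implicit.
Unset Printing Implicit Defensive.

Local Open Scope classical_set_scope.

(** The phantom parameter [r] lets the topology, which depends on [r], be attached to the type. *)
Definition adjoin_nat (L : topologicalType) (r : nat -> L) : Type :=
  (L + nat)%type.

(** * Topology on the disjoint union of [L] and [nat] *)

Section AdjoinNat.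
Context (L : topologicalType) (r : nat -> L).
Local Notation K := (adjoin_nat r).

HB.instance Definition _ := Choice.copy K (L + nat)%type.

Definition adjoin_old (x : L) : K := inl x.
Definition adjoin_new (n : nat) : K := inr n.
Definition adjoin_retract (z : K) : L :=
  match z with inl x => x | inr n => r n end.

(** New points are isolated, since nothing is asked at them. At an old point [x], [U] must contain
    every new [n] with [n] large and [r n] near [x]; the equation [r n = y] expresses this through
    the product filter. *)
Definition adjoin_open : set_system K := [set U |
  open (adjoin_old @^-1` U) /\
  forall x, U (adjoin_old x) ->
    \forall y \near x & n \near \oo, r n = y -> U (adjoin_new n)].

Lemma adjoin_openT : adjoin_open setT.
Proof. by split=> [|x _]; [exact: openT|apply: filterE => -[]]. Qed.

Lemma adjoin_openI : setI_closed adjoin_open.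
Proof.
move=> U V [oU nU] [oV nV]; split=> [|x [Ux Vx]]; first exact: openI.
by apply: filterS2 (nU x Ux) (nV x Vx) => -[y n] /= ? ? ?; split; auto.
Qed.

Lemma adjoin_open_bigU (I : Type) (U : I -> set K) :
  (forall i, adjoin_open (U i)) -> adjoin_open (\bigcup_i U i).
Proof.
move=> oU; split=> [|x [i _ Uix]].
  by rewrite preimage_bigcup; apply: bigcup_open => i _; have [] := oU i.
have [_ /(_ x Uix)] := oU i.
by apply: filterS => -[y n] /= Uin rny; exists i; auto.
Qed.

HB.instance Definition _ :=
  isOpenTopological.Build K adjoin_openT adjoin_openI adjoin_open_bigU.

Lemma adjoin_old_continuous : continuous adjoin_old.
Proof. by apply/continuousP => U []. Qed.

Lemma adjoin_retract_continuous : continuous adjoin_retract.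
Proof.
apply/continuousP => U oU; split=> // x Ux.
exists (U, setT) => /=; last by move=> [y n] /= [Uy _] ->.
by split; [exact: open_nbhs_nbhs|exact: filterT].
Qed.

Lemma open_adjoin_new (A : set nat) : open (adjoin_new @` A).
Proof.
split=> [|x [] //]; suff -> : adjoin_old @^-1` (adjoin_new @` A) = set0.
  exact: open0.
by apply/seteqP; split=> // x [].
Qed.

Lemma open_setC_adjoin_new (n : nat) : open (~` [set adjoin_new n]).
Proof.
split=> [|x _].
  suff -> : adjoin_old @^-1` (~` [set adjoin_new n]) = setT by exact: openT.
  exact/seteqP.
exists (setT, [set m | n < m]%N) => /=.
  by split; [exact: filterT|exact: nbhs_infty_gt].
by move=> [y m] /= [_ nm] _ [mn]; rewrite mn ltnn in nm.
Qed.

(** Points with distinct retractions are separated by preimages of open sets of [L]. Distinct points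
    with the same retraction are not both old, and a new point is clopen. *)
Lemma adjoin_hausdorff : hausdorff_space L -> hausdorff_space K.
Proof.
rewrite !open_hausdorff => hL z w zw.
suff [[A B] /= [Az Bw oA oB AB]] : exists AB : set K * set K,
    [/\ AB.1 z, AB.2 w, open AB.1, open AB.2 & AB.1 `&` AB.2 = set0].
  by exists (A, B); rewrite ?inE; split=> //; apply/eqP.
have [pzw|] := eqVneq (adjoin_retract z) (adjoin_retract w); last first.
  move=> /hL[[A B]] /= []; rewrite !inE => Az Bw [oA oB AB].
  exists (adjoin_retract @^-1` A, adjoin_retract @^-1` B) => /=; split=> //.
  - by move/continuousP: adjoin_retract_continuous; apply.
  - by move/continuousP: adjoin_retract_continuous; apply.
  - by rewrite -preimage_setI AB preimage_set0.
have on n : open [set adjoin_new n] by rewrite -image_set1; exact: open_adjoin_new.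
have oC := open_setC_adjoin_new.
case: z w zw pzw => [x|n] [y|m] /eqP zw /= pzw.
- by rewrite pzw in zw.
- by exists (~` [set adjoin_new m], [set adjoin_new m]); split; rewrite //= setICl.
- exists ([set adjoin_new n], ~` [set adjoin_new n]).
  by split; rewrite //= ?setICr // => /esym.
- exists ([set adjoin_new n], ~` [set adjoin_new n]).
  by split; rewrite //= ?setICr // => /esym.
Qed.

Lemma adjoin_compact : compact [set: L] -> compact [set: K].
Proof.
move=> cL F FF _.
have [[n Fn]|Fnew] := pselect (exists n, forall A, F A -> A (adjoin_new n)).
  exists (adjoin_new n); split=> // A B /Fn An /nbhs_singleton Bn.
  by exists (adjoin_new n).
(* When [F] clusters at no new point in the trivial way, it eventually leaves each finite set of new
   points. A cluster point of its image in [L] then serves. *)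
have Fge N : F [set z | forall n, (n < N)%N -> z <> adjoin_new n].
  elim: N => [|N IH]; first exact: filterE.
  move/forallNP/(_ N)/existsNP: Fnew => [A /not_implyP [FA AN]].
  apply: filterS2 FA IH => z Az zN n; rewrite ltnS leq_eqVlt => /predU1P[->|].
    by move=> zE; rewrite zE in Az.
  exact: zN.
have [x [_ Fx]] := cL (adjoin_retract @ F) _ filterT.
exists (adjoin_old x); split=> // A B FA.
rewrite nbhsE => -[U [oU Ux] UB].
case: (oU) => oUL /(_ x Ux) [[V W] /= [Vx [N _ NW]] VW].
(* The point [z] obtained lies in [U] either way: if old, by the choice of the second set; if new,
   because its index is at least [N] and its retraction is in [V]. *)
have [||y [[z [Az zN] <-] [Vz Uz]]] := Fx
    (adjoin_retract @` (A `&` [set z | forall n, (n < N)%N -> z <> adjoin_new n]))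
    (V `&` adjoin_old @^-1` U).
- apply: (@filterS _ F _ _ _ _ (filterI FA (Fge N))); exact: preimage_image.
- by apply: filterI => //; exact: open_nbhs_nbhs.
exists z; split=> //; apply: UB.
case: z Az zN Vz Uz => [//|n] Az zN Vz Uz.
apply: (VW (r n, n)) => //; split=> //; apply: NW => /=.
by rewrite leqNgt; apply/negP => /zN.
Qed.

Lemma adjoin_new_embedding : embedding adjoin_new.
Proof.
split; first by move=> m n [].
apply/funext => A; apply/propext; split=> _; last exact: discrete_open.
exists (adjoin_new @` A); first exact: open_adjoin_new.
by apply/seteqP; split=> [n [m Am [<-]]|n An] //; exists n.
Qed.

(** The recurrence of [r] provides, in any neighbourhood of an old point, a new point of large
    index. *)
Lemma adjoin_new_dense :
  (forall U : set L, open U -> U !=set0 ->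
    forall N, exists2 n, (N <= n)%N & U (r n)) ->
  dense (range adjoin_new).
Proof.
move=> rU A [[x|n] Az] oA; last by exists (adjoin_new n); split=> //; exists n.
have [oAL /(_ x Az) [[V W] /= [Vx [N _ NW]] VW]] := oA.
move: Vx; rewrite nbhsE => -[V' [oV' V'x] V'V].
have [n Nn V'n] := rU V' oV' (ex_intro _ x V'x) N.
exists (adjoin_new n); split; last by exists n.
by apply: (VW (r n, n)) => //; split=> /=; [exact: V'V|exact: NW].
Qed.

End AdjoinNat.

(** * The remainder as a copy of [L] *)

Section AdjoinNatCompact.
Context (L : compactHausdorffType) (r : nat -> L).
Local Notation K := (adjoin_nat r).

HB.instance Definition _ := isCompactHausdorff.Build K
  (adjoin_compact (@compactHausdorff_compact L))
  (adjoin_hausdorff (@compactHausdorff_hausdorff L)).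

Lemma remainder_adjoin_new : remainder (@adjoin_new L r) = range (@adjoin_old L r).
Proof.
apply/seteqP; split=> [[x|n] nz|z [x _ <-] [] //]; first by exists x.
by exfalso; apply: nz; exists n.
Qed.

Lemma remainder_adjoin_homeomorphic :
  homeomorphic (remainder (@adjoin_new L r) : Type) L.
Proof.
have oldR x : adjoin_old r x \in remainder (@adjoin_new L r).
  by rewrite inE remainder_adjoin_new; exists x.
pose f (z : remainder (@adjoin_new L r)) : L := adjoin_retract (set_val z).
pose g x : remainder (@adjoin_new L r) := SigSub (oldR x).
exists f, g; split=> //.
- case=> z zR; apply: val_inj.
  suff : adjoin_old r (adjoin_retract z) = z by [].
  by move: zR; rewrite inE remainder_adjoin_new => -[x _ <-].
- move=> z; apply: continuous_comp; first exact: initial_continuous.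
  exact: adjoin_retract_continuous.
- by apply: continuous_comp_initial => x; exact: adjoin_old_continuous.
Qed.

End AdjoinNatCompact.

Local Open Scope ring_scope.

(** * The projection induced by a retraction *)

Section RetractionProjection.
Context (R : realType) (K : compactHausdorffType) (p : K -> K)
  (p_continuous : continuous p).

Lemma cspace_comp_subproof (f : cspace R K) :
  (f \o p : K -> R^o) \in @continuous_pred R K.
Proof.
apply/continuous_predP => x; apply: continuous_comp; first exact: p_continuous.
exact: cspace_continuous.
Qed.

Definition cspace_comp (f : cspace R K) : cspace R K :=
  CSpace (cspace_comp_subproof f).

Lemma cspace_comp_le (f : cspace R K) : `|cspace_comp f| <= `|f|.
Proof.
by apply: sup_norm_le => [|x]; [exact: sup_norm_ge0|exact: (ler_sup_norm f (p x))].
Qed.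

Definition cspace_proj (f : cspace R K) : cspace R K := f - cspace_comp f.

Lemma cspace_proj_linear : linear cspace_proj.
Proof.
move=> a f g; apply/val_inj/funext => x.
rewrite -[LHS]/((a * f x + g x) - (a * f (p x) + g (p x))).
rewrite -[RHS]/(a * (f x - f (p x)) + (g x - g (p x))).
by rewrite mulrBr opprD addrACA.
Qed.

HB.instance Definition _ :=
  GRing.isLinear.Build R (cspace R K) (cspace R K) *:%R cspace_proj
    cspace_proj_linear.

(** The function [f - f \o p] vanishes where [p] is the identity, and it equals [f] when [f]
    vanishes on the remainder, where [p] takes its values. *)
Lemma smooth_of_retraction (i : nat -> K) :
  (forall x, remainder i (p x)) -> (forall x, remainder i x -> p x = x) ->
  smooth R i.
Proof.
move=> pR pK.
have proj0 f x : remainder i x -> cspace_proj f x = 0.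
  by move=> /pK px; rewrite -[LHS]/(f x - f (p x)) px subrr.
have projK f : c0_copy R i f -> cspace_proj f = f.
  move=> f0; apply/val_inj/funext => x.
  by rewrite -[LHS]/(f x - f (p x)) (f0 _ (pR x)) subr0.
exists cspace_proj; split.
- exists 2 => f; apply: le_trans (ler_normB _ _) _.
  by rewrite mulr_natl mulr2n lerD2l cspace_comp_le.
- by move=> f; apply: projK => x; exact: proj0.
- apply/seteqP; split=> [_ [f _ <-] x|f /projK <-]; first exact: proj0.
  by exists f.
Qed.

End RetractionProjection.

(** * Recurrent dense sequences and the conclusion *)

Lemma separable_recurrent_sequence (L : topologicalType) :
  [set: L] !=set0 -> separable L -> exists r : nat -> L,
    forall U : set L, open U -> U !=set0 ->
      forall N, exists2 n, (N <= n)%N & U (r n).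
Proof.
move=> [x0 _] [D /pfcard_geP[D0|[s]] dD].
  have [x [_]] := dD setT (ex_intro _ x0 I) openT.
  by rewrite D0.
(* The 2-adic valuation takes each value [k] infinitely often: at [2 ^ k] times any odd number, here
   [2N + 1] to exceed [N]. *)
exists (fun n => s (logn 2 n)) => U oU U0 N.
have [x [Ux Dx]] := dD U U0 oU.
have [k _ kx] := 'surj_s Dx.
exists (2 ^ k * N.*2.+1)%N.
  rewrite (leq_trans _ (leq_pmull _ _)) ?expn_gt0// -addnn.
  by rewrite leqW// leq_addr.
rewrite lognM ?expn_gt0// pfactorK// (@lognE 2 N.*2.+1) dvdn2 /= odd_double /=.
by rewrite addn0 kx.
Qed.

Theorem theorem4p3 (R : realType) (L : compactHausdorffType)
    (L_nonempty : [set: L] !=set0) (L_separable : separable L)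
    (L_zerodim : has_clopen_base L) :
  exists (K : compactHausdorffType) (i : nat -> K),
    [/\ nat_compactification i, smooth R i
      & homeomorphic (remainder i : Type) L].
Proof.
have [r rU] := separable_recurrent_sequence L_nonempty L_separable.
exists (adjoin_nat r), (@adjoin_new L r); split.
- by split; [exact: adjoin_new_embedding|exact: adjoin_new_dense].
(* The retraction onto the remainder, as a self-map of the compactification. *)
- have pc : continuous (@adjoin_old L r \o @adjoin_retract L r).
    move=> z; apply: continuous_comp; first exact: adjoin_retract_continuous.
    exact: adjoin_old_continuous.
  apply: (smooth_of_retraction R pc) => z; rewrite remainder_adjoin_new.
    by exists (adjoin_retract z).
  by case=> x _ <-.
- exact: remainder_adjoin_homeomorphic.
Qed.
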